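(* Let $\mathcal F=\{f_i(x)=r_ix+b_i\}_{i=1}^m$ be an affine reverse iterated function system on $\mathbb R$, with $r_i,b_i\in\mathbb R$ and $|r_i|>1$ for all $i$. For every $t\ge 0$ the limit $$P(t):=\lim_{n\to\infty}\frac1n\log\sum_{g\in\{f_{\mathbf i}:\mathbf i\in\Sigma^n\}}|g'|^{-t}$$ exists. Moreover, the following three quantities coincide: (i) $d_{\mathcal F}$; (ii) the unique zero of $P(t)$ (on $[0,\infty)$); (iii) $\inf\Big\{t\ge0:\sum_{g\in G^*(\mathcal F)}|g'|^{-t}<\infty\Big\}$.
   Context: The maps $f_1,\dots,f_m$ are distinct. $\Sigma^n=\{1,\dots,m\}^n$, and for $\mathbf i=i_1\cdots i_n\in\Sigma^n$, $f_{\mathbf i}=f_{i_1}\circ\cdots\circ f_{i_n}$. The set $\{f_{\mathbf i}:\mathbf i\in\Sigma^n\}$ is a set of distinct maps (words giving the same map are counted once). $G^*(\mathcal F)=\bigcup_{n\ge1}\{f_{\mathbf i}:\mathbf i\in\Sigma^n\}$ is the semigroup of distinct maps generated by $\mathcal F$, and $|g'|$ is the absolute value of the linear coefficient of the affine map $g$. The exponent $d_{\mathcal F}$ is defined by $$d_{\mathcal F}=\lim_{R\to\infty}\frac{\log\#\{g\in G^*(\mathcal F):|g'|\le R\}}{\log R},$$ a limit which always exists. *)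

(* Defs.v *)
From HB Require Import structures.
From mathcomp Require Import all_boot all_order all_algebra finmap.
From mathcomp Require Import all_classical all_reals all_analysis.
Set Implicit Arguments.
Unset Strict Implicit.
Unset Printing Implicit Defensive.
Import Order.TTheory GRing.Theory Num.Theory.
Import numFieldNormedType.Exports.
Local Open Scope classical_set_scope.
Local Open Scope ring_scope.

Definition affine (R : realType) (a b : R) : R -> R := fun x => a * x + b.

(* The linear coefficient of an affine self-map of R, see lincoef_affine; it is
   a function of the map itself, so that it makes sense on sets of maps. *)
Definition lincoef (R : realType) (g : R -> R) : R := g 1 - g 0.

Lemma lincoef_affine (R : realType) (a b : R) : lincoef (affine a b) = a.
Proof. by rewrite /lincoef /affine mulr1 mulr0 add0r addrK. Qed.

Section RIFS.
Context {R : realType} {m : nat}.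
Implicit Types (F : 'I_m -> R -> R) (t x : R).

(* f_(i_1 ... i_n) = f_(i_1) \o ... \o f_(i_n) *)
Definition word_map F (w : seq 'I_m) : R -> R :=
  foldr (fun i g => F i \o g) id w.

(* Sets of functions: words inducing the same map are counted once. *)
Definition level F (n : nat) : set (R -> R) :=
  [set word_map F w | w in [set: n.-tuple 'I_m]].

Definition Gstar F : set (R -> R) :=
  \bigcup_(n in [set n | (0 < n)%N]) level F n.

Definition pressure_seq F t : R^nat := fun n =>
  n%:R^-1 * ln (\sum_(g \in level F n) `|lincoef g| `^ (- t)).

Definition pressure F t : R := limn (pressure_seq F t).

(* #|` fset_set A | is the cardinality of A when A is finite (and 0 otherwise);
   the sets below are finite when all the maps are expanding. *)
Definition growth_ratio F x : R :=
  ln (#|` fset_set [set g | Gstar F g /\ `|lincoef g| <= x] |%:R) / ln x.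

Definition growth_exponent F : R := lim (growth_ratio F x @[x --> +oo]).

Definition poincare_series F t : \bar R :=
  (\esum_(g in Gstar F) (`|lincoef g| `^ (- t))%:E)%E.

(* The infimum is taken in the extended reals, so that it is +oo if the series
   diverges for every t. *)
Definition critical_exponent F : \bar R :=
  ereal_inf [set t%:E | t in [set t | 0 <= t /\ (poincare_series F t < +oo)%E]].

End RIFS.

(* Main.v *)
Require Import Defs.
From mathcomp Require Import all_boot all_order all_algebra finmap.
From mathcomp Require Import all_classical all_reals all_analysis.
From mathcomp Require Import ring lra.
Set Implicit Arguments.
Unset Strict Implicit.
Unset Printing Implicit Defensive.
Import Order.TTheory GRing.Theory Num.Theory.
Import numFieldNormedType.Exports.
Local Open Scope classical_set_scope.
Local Open Scope ring_scope.

(** Write S_n(t) for the sum of |g'|^-t over the distinct maps g of level n.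
    Every map of level n + k is a composite of one of level n and one of level
    k, and |g'| is multiplicative, so S_(n+k)(t) <= S_n(t) S_k(t): the limit
    P(t) exists by Fekete's lemma (subadditive_cvg). If every |r_i| lies in
    [lam, Lam] with lam > 1, then |g'| lies in [lam^n, Lam^n] on level n, whence
    (t - s) ln lam <= P(s) - P(t) <= (t - s) ln Lam for s <= t. Together with
    P(0) >= 0, this gives P a unique zero s0 (pressure_zero_exists).

    If t > s0, then S_n(t) decays geometrically, so the sums of |g'|^-t over
    finite sets of maps of the semigroup are bounded (sum_words_bounded). Hence
    the series in (iii) converges, and at most C x^t maps have |g'| <= x. The
    levels may overlap, but this can only decrease the sums. If t < s0, then
    S_n(t) is unbounded, and since each level is contained in the semigroup, the
    series diverges.

    There remains the lower bound on the number N(x) of maps with |g'| <= x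
    (identity included), for all large x and not only along a subsequence.
    Cutting a word after its longest prefix of ratio at most Lam x gives
    N(Lam x y) <= N(Lam x) N(Lam y), hence N(Lam x^k) <= N(Lam x)^k for k > 0.
    If N(Lam x) < x^t held for a single x > 1, a summation over the shells
    Lam x^k < |g'| <= Lam x^(k+1) would bound every S_n(t) by a geometric
    series (level_sum_bounded_of_count), which is impossible for t < s0. So
    N(Lam x) >= x^s0 for every x > 1 (ln_count_ge). *)

(** * Preliminaries on sums and sequences *)

Lemma ler_sum_sub_seq (R : realDomainType) (T : eqType) (f : T -> R)
    (s t : seq T) :
  (forall x, 0 <= f x) -> uniq s -> {subset s <= t} ->
  \sum_(x <- s) f x <= \sum_(x <- t) f x.
Proof.
move=> f0; elim: s t => [|x s IH] t /=; first by rewrite big_nil sumr_ge0.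
case/andP=> xs us st.
have xt : x \in t by apply: st; rewrite mem_head.
rewrite big_cons (perm_big _ (perm_to_rem xt)) big_cons lerD2l; apply: IH => //.
move=> y ys; have := st y; rewrite inE ys orbT => /(_ isT).
rewrite (perm_mem (perm_to_rem xt)) inE => /orP[/eqP yx|//].
by rewrite -yx ys in xs.
Qed.

(** Fekete's lemma. The lower bound u n >= n c makes the infimum of the
    ratios u n / n finite. *)
Lemma subadditive_cvg (R : realType) (u : R^nat) (c : R) :
  (forall n k, u (n + k)%N <= u n + u k) -> (forall n, n%:R * c <= u n) ->
  cvgn (fun n => n%:R^-1 * u n).
Proof.
move=> subu lbu.
pose E := [set n.+1%:R^-1 * u n.+1 | n in [set: nat]].
have lbE : lbound E c.
  by move=> _ [n _ <-]; rewrite ler_pdivlMl ?ltr0n// mulrC.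
have hasE : has_inf E.
  by split; [exists (1%:R^-1 * u 1%N); exists 0%N | exists c].
apply/cvg_ex; exists (inf E); apply/cvgrPdist_le => /= e e0.
have e20 : 0 < e / 2 by rewrite divr_gt0.
have [_ [k _ <-] uk] := inf_adherent e20 hasE.
(* Subtracting n c makes the sequence nonnegative, so that the bound
   q <= n / k.+1 can be used below whatever the sign of u k.+1. *)
pose v n := u n - n%:R * c.
have v0 n : 0 <= v n by rewrite subr_ge0.
pose M := \sum_(j < k.+1) v j.
have M0 : 0 <= M by apply: sumr_ge0.
have vq q j : v (q * k.+1 + j)%N <= q%:R * v k.+1 + v j.
  rewrite /v; have : u (q * k.+1 + j)%N <= q%:R * u k.+1 + u j.
    elim: q => [|q IH]; first by rewrite mul0n mul0r add0r add0n.
    rewrite mulSn -addnA (le_trans (subu _ _))// -[q.+1%:R]natr1.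
    lra.
  by rewrite natrD natrM; lra.
have bound n : (0 < n)%N ->
    n%:R^-1 * u n <= k.+1%:R^-1 * u k.+1 + n%:R^-1 * M.
  move=> n0.
  have vn : v n <= n%:R / k.+1%:R * v k.+1 + M.
    rewrite {1}(divn_eq n k.+1) (le_trans (vq _ _))// lerD//.
      apply: ler_wpM2r => //; rewrite ler_pdivlMr ?ltr0n// -natrM ler_nat.
      exact: leq_divM.
    have jk : (n %% k.+1 < k.+1)%N by rewrite ltn_mod.
    by rewrite /M (bigD1 (Ordinal jk))//= lerDl sumr_ge0.
  rewrite ler_pdivrMl ?ltr0n//; move: vn; rewrite /v.
  have kne : k.+1%:R != 0 :> R by rewrite pnatr_eq0.
  have nne : n%:R != 0 :> R by rewrite pnatr_eq0 -lt0n.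
  have -> : n%:R / k.+1%:R * (u k.+1 - k.+1%:R * c) + M =
    n%:R * (k.+1%:R^-1 * u k.+1 + n%:R^-1 * M) - n%:R * c by field; apply/andP.
  by rewrite lerD2r.
near=> n.
have n0 : (0 < n)%N by near: n; exact: nbhs_infty_gt.
have nM : n%:R^-1 * M <= e / 2.
  rewrite ler_pdivrMl ?ltr0n// mulrC -ler_pdivrMl//.
  by near: n; exact: nbhs_infty_ger.
rewrite ler_distlC; apply/andP; split; last first.
  have := bound n n0; move: uk nM.
  by set x := _ * u k.+1; set y := _ * u n; set z := _ * M; lra.
apply: (@le_trans _ _ (inf E)); first by rewrite lerBlDr lerDl ltW.
apply: ge_inf; first by exists c.
by exists n.-1 => //; rewrite prednK.
Unshelve. all: by end_near. Qed.

Lemma sum_expr_le (R : realFieldType) (q : R) n :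
  0 <= q < 1 -> \sum_(i < n) q ^+ i <= (1 - q)^-1.
Proof.
move=> /andP[q0 q1]; have d0 : 0 < 1 - q by rewrite subr_gt0.
rewrite -[leRHS]mul1r ler_pdivlMr//.
have -> : (\sum_(i < n) q ^+ i) * (1 - q) = 1 - q ^+ n.
  by rewrite -[1 - q ^+ n]opprB subrX1 mulrC; ring.
by rewrite gerBl exprn_ge0.
Qed.

Lemma expr_gt_exists (R : realType) (a x : R) : 1 < a -> exists k, x < a ^+ k.
Proof.
move=> a1; have a0 : 0 < a := lt_trans ltr01 a1.
have [x0|x0] := lerP x 0; first by exists 0%N; exact: le_lt_trans x0 _.
exists (Num.truncn (ln x / ln a)).+1.
rewrite -ltr_ln ?posrE ?exprn_gt0// lnXn// -mulr_natl -ltr_pdivrMr ?ln_gt0//.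
exact: truncnS_gt.
Qed.

Lemma powRN_homo (R : realType) (t x y : R) :
  0 <= t -> 0 < x -> x <= y -> y `^ (- t) <= x `^ (- t).
Proof.
move=> t0 x0 xy; have y0 := lt_le_trans x0 xy.
rewrite !powRN lef_pV2 ?posrE ?powR_gt0// ge0_ler_powR ?nnegrE//; exact: ltW.
Qed.

Lemma powRX (R : realType) (x t : R) n :
  0 <= x -> (x `^ t) ^+ n = (x ^+ n) `^ t.
Proof.
move=> x0; elim: n => [|n IH]; first by rewrite !expr0 powR1.
by rewrite !exprS IH powRM// exprn_ge0.
Qed.

(** The zero is the supremum of the t with P t >= 0: by the bound with slope L,
    neither P < 0 nor P > 0 is possible there. *)
Lemma decreasing_lipschitz_zero (R : realType) (P : R -> R) (l L : R) :
  0 < l -> 0 < L -> 0 <= P 0 ->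
  (forall s t, 0 <= s -> s <= t ->
     P s - (t - s) * L <= P t <= P s - (t - s) * l) ->
  exists2 s, 0 <= s & P s = 0.
Proof.
move=> l0 L0 P0 shift.
pose E := [set t | 0 <= t /\ 0 <= P t].
have E0 : E 0 by [].
have hasE : has_sup E.
  split; first by exists 0.
  exists (P 0 / l) => t [t0 Pt].
  have /andP[_] := shift 0 t (lexx 0) t0.
  by rewrite ler_pdivlMr// subr0; lra.
have s0 : 0 <= sup E by exact: (sup_upper_bound hasE E0).
exists (sup E) => //; apply: le_anti; apply/andP; split; rewrite leNgt;
  apply/negP => Ps.
- have d0 : 0 < P (sup E) / L by rewrite divr_gt0.
  set d := _ / _ in d0; suff : E (sup E + d).
    by move/(sup_upper_bound hasE); rewrite gerDl leNgt d0.
  split; first by rewrite addr_ge0// ltW.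
  have sd : sup E <= sup E + d by rewrite lerDl ltW.
  have /andP[h _] := shift _ _ s0 sd.
  apply: le_trans h.
  by rewrite [_ + d]addrC addrK divfK ?subrr// gt_eqF.
- have d0 : 0 < - P (sup E) / L by rewrite divr_gt0// oppr_gt0.
  have [t [t0 Pt] ht] := sup_adherent d0 hasE.
  have tE : t <= sup E by exact: (sup_upper_bound hasE (conj t0 Pt)).
  have /andP[h _] := shift _ _ t0 tE.
  have : (sup E - t) * L < - P (sup E) by rewrite -ltr_pdivlMr//; lra.
  by lra.
Qed.

(** * Ratios of words and sums over levels *)

Section Expanding.
Context {R : realType} {m : nat} (r b : 'I_m -> R) (lam Lam : R).
Context (m_gt0 : (0 < m)%N) (lam_gt1 : 1 < lam).
Context (ratio_bounds : forall i, lam <= `|r i| <= Lam).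
Implicit Types (s t x y : R) (n k : nat) (w : seq 'I_m) (g h : R -> R).

Let F := fun i : 'I_m => affine (r i) (b i).

(** The absolute value of the linear coefficient of the map of the word w. *)
Definition ratio w : R := \prod_(i <- w) `|r i|.

Lemma lam_gt0 : 0 < lam. Proof. exact: lt_trans lam_gt1. Qed.

Lemma Lam_gt1 : 1 < Lam.
Proof.
have /andP[h1 h2] := ratio_bounds (Ordinal m_gt0).
exact: lt_le_trans lam_gt1 (le_trans h1 h2).
Qed.

Lemma Lam_gt0 : 0 < Lam. Proof. exact: lt_trans Lam_gt1. Qed.

Lemma word_map_cat u v : word_map F (u ++ v) = word_map F u \o word_map F v.
Proof. by elim: u => [|i u IH] //=; rewrite IH. Qed.

Lemma lincoef_word_map w : `|lincoef (word_map F w)| = ratio w.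
Proof.
rewrite /ratio -normr_prod; congr `|_|.
suff [c ->] : exists c, word_map F w = affine (\prod_(i <- w) r i) c.
  exact: lincoef_affine.
elim: w => [|i w [c IH]] /=.
  by exists 0; rewrite big_nil; apply/funext => x; rewrite /affine mul1r addr0.
exists (r i * c + b i); rewrite big_cons IH; apply/funext => x.
by rewrite /F /affine /=; ring.
Qed.

Lemma ratio_cat u v : ratio (u ++ v) = ratio u * ratio v.
Proof. exact: big_cat. Qed.

Lemma ratio_ge w : lam ^+ size w <= ratio w.
Proof.
elim: w => [|i w IH]; first by rewrite /ratio big_nil.
rewrite /ratio big_cons exprS ler_pM// ?exprn_ge0// ?(ltW lam_gt0)//.
by have /andP[] := ratio_bounds i.
Qed.

Lemma ratio_le w : ratio w <= Lam ^+ size w.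
Proof.
elim: w => [|i w IH]; first by rewrite /ratio big_nil.
rewrite /ratio big_cons exprS ler_pM// ?prodr_ge0//.
by have /andP[] := ratio_bounds i.
Qed.

Lemma ratio_ge1 w : 1 <= ratio w.
Proof. exact: le_trans (exprn_ege1 _ (ltW lam_gt1)) (ratio_ge w). Qed.

Lemma ratio_gt0 w : 0 < ratio w.
Proof. exact: lt_le_trans (ratio_ge1 w). Qed.

Lemma levelP n g : level F n g <-> exists2 w, size w = n & g = word_map F w.
Proof.
split=> [[w _ <-]|[w wn ->]]; first by exists w; rewrite ?size_tuple.
by have /eqP wn' := wn; exists (Tuple wn').
Qed.

Lemma finite_level n : finite_set (level F n).
Proof. by apply: finite_image; exact: finite_finset. Qed.

(** The maps of level n, as a finite set (each map is listed once). *)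
Definition level_fset n := fset_set (level F n).

Lemma level_fsetP n g : reflect (exists2 w, size w = n & g = word_map F w)
  (g \in level_fset n).
Proof.
rewrite in_fset_set; last exact: finite_level.
by apply: (iffP idP); rewrite inE => /levelP.
Qed.

(** The sum S_n(t) of |g'|^-t over the distinct maps g of level n. *)
Definition level_sum t n := \sum_(g <- level_fset n) `|lincoef g| `^ (- t).

Lemma pressure_seqE t n : pressure_seq F t n = n%:R^-1 * ln (level_sum t n).
Proof. by rewrite /pressure_seq fsbig_finite//; exact: finite_level. Qed.

Lemma level_sum_ge0 t n : 0 <= level_sum t n.
Proof. by apply: sumr_ge0 => g _; exact: powR_ge0. Qed.

Lemma level_sum_ge_word t w : ratio w `^ (- t) <= level_sum t (size w).
Proof.
rewrite -lincoef_word_map.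
have -> : `|lincoef (word_map F w)| `^ (- t) =
    \sum_(g <- [:: word_map F w]) `|lincoef g| `^ (- t) by rewrite big_seq1.
apply: ler_sum_sub_seq => // g.
by rewrite inE => /eqP ->; apply/level_fsetP; exists w.
Qed.

Lemma level_sum_gt0 t n : 0 < level_sum t n.
Proof.
have := level_sum_ge_word t (nseq n (Ordinal m_gt0)); rewrite size_nseq.
by apply: lt_le_trans; rewrite powR_gt0// ratio_gt0.
Qed.

Lemma level_sum_submul t n k :
  level_sum t (n + k) <= level_sum t n * level_sum t k.
Proof.
have -> : level_sum t n * level_sum t k =
    \sum_(g <- [seq g \o h | g <- level_fset n, h <- level_fset k])
      `|lincoef g| `^ (- t).
  rewrite big_allpairs_dep big_seq mulr_suml big_seq.
  apply: eq_bigr => g /level_fsetP[u _ ->].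
  rewrite mulr_sumr big_seq [RHS]big_seq.
  apply: eq_bigr => h /level_fsetP[v _ ->].
  by rewrite -word_map_cat !lincoef_word_map ratio_cat powRM// ltW ?ratio_gt0.
apply: ler_sum_sub_seq => // g /level_fsetP[w wnk ->].
apply/allpairsP; exists (word_map F (take n w), word_map F (drop n w)) => /=.
rewrite -word_map_cat cat_take_drop; split=> //; apply/level_fsetP.
- by exists (take n w) => //; rewrite size_takel// wnk leq_addr.
- by exists (drop n w) => //; rewrite size_drop wnk addKn.
Qed.

Lemma level_sum_shift s t n : s <= t ->
  level_sum s n * (Lam ^+ n) `^ (- (t - s)) <= level_sum t n <=
  level_sum s n * (lam ^+ n) `^ (- (t - s)).
Proof.
move=> st; have ts : 0 <= t - s by rewrite subr_ge0.
rewrite /level_sum !mulr_suml; apply/andP.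
split; rewrite big_seq [leRHS]big_seq;
  apply: ler_sum => g /level_fsetP[w wn ->]; rewrite lincoef_word_map;
  have -> : - t = - s + - (t - s) by [lra];
  rewrite (@powRD _ (ratio w)) ?(gt_eqF (ratio_gt0 w)) ?implybT//;
  apply: ler_wpM2l; rewrite ?powR_ge0//; apply: powRN_homo => //.
- exact: ratio_gt0.
- by rewrite -wn ratio_le.
- by rewrite exprn_gt0 ?lam_gt0.
- by rewrite -wn ratio_ge.
Qed.

Lemma ln_level_sum_shift s t n : s <= t ->
  ln (level_sum s n) - n%:R * ((t - s) * ln Lam) <= ln (level_sum t n) <=
  ln (level_sum s n) - n%:R * ((t - s) * ln lam).
Proof.
move=> /(level_sum_shift n)/andP[h1 h2].
have E a : 0 < a -> ln (level_sum s n * (a ^+ n) `^ (- (t - s))) =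
    ln (level_sum s n) - n%:R * ((t - s) * ln a).
  move=> a0; rewrite lnM ?posrE ?level_sum_gt0 ?powR_gt0 ?exprn_gt0//.
  rewrite ln_powR lnXn// mulrnAr -mulr_natl; ring.
rewrite -!E ?lam_gt0 ?Lam_gt0//.
rewrite !ler_ln ?posrE ?mulr_gt0 ?level_sum_gt0 ?powR_gt0 ?exprn_gt0//;
  rewrite ?lam_gt0 ?Lam_gt0//.
by rewrite h1 h2.
Qed.

Lemma level_sum0_ge1 n : 1 <= level_sum 0 n.
Proof.
have := level_sum_ge_word 0 (nseq n (Ordinal m_gt0)).
by rewrite size_nseq oppr0 powRr0.
Qed.

(** * The pressure *)

Lemma pressure_cvg t : 0 <= t -> cvgn (pressure_seq F t).
Proof.
move=> t0.
have -> : pressure_seq F t = fun n => n%:R^-1 * ln (level_sum t n).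
  by apply/funext => n; exact: pressure_seqE.
apply: (@subadditive_cvg _ _ (- (t * ln Lam))) => [n k|n].
  rewrite -lnM ?posrE ?level_sum_gt0// ler_ln ?posrE ?mulr_gt0 ?level_sum_gt0//.
  exact: level_sum_submul.
have /andP[h _] := ln_level_sum_shift n t0; have := ln_ge0 (level_sum0_ge1 n).
by move: h; rewrite subr0 mulrN; lra.
Qed.

(** On [0, +oo[, P is strictly decreasing and Lipschitz continuous. *)
Lemma pressure_shift s t : 0 <= s -> s <= t ->
  pressure F s - (t - s) * ln Lam <= pressure F t <=
  pressure F s - (t - s) * ln lam.
Proof.
move=> s0 st; have cs := pressure_cvg s0.
have ct := pressure_cvg (le_trans s0 st).
have E a n : (0 < n)%N ->
    n%:R^-1 * (ln (level_sum s n) - n%:R * ((t - s) * a)) =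
    n%:R^-1 * ln (level_sum s n) - (t - s) * a.
  move=> n0; rewrite mulrBr mulKf// pnatr_eq0 -lt0n//.
have cB a : (fun n => pressure_seq F s n - (t - s) * a) n @[n --> \oo] -->
    pressure F s - (t - s) * a
  by exact: cvgB cs (cvg_cst _).
apply/andP; split.
- apply: (ler_cvg_to (cB _) ct); near=> n.
  have n0 : (0 < n)%N by near: n; exact: nbhs_infty_gt.
  rewrite !pressure_seqE -E// ler_pM2l ?invr_gt0 ?ltr0n//.
  by have /andP[] := ln_level_sum_shift n st.
- apply: (ler_cvg_to ct (cB _)); near=> n.
  have n0 : (0 < n)%N by near: n; exact: nbhs_infty_gt.
  rewrite !pressure_seqE -E// ler_pM2l ?invr_gt0 ?ltr0n//.
  by have /andP[] := ln_level_sum_shift n st.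
Unshelve. all: by end_near. Qed.

Lemma pressure0_ge0 : 0 <= pressure F 0.
Proof.
apply: limr_ge; first exact: pressure_cvg.
by near=> n; rewrite pressure_seqE mulr_ge0 ?invr_ge0// ln_ge0// level_sum0_ge1.
Unshelve. all: by end_near. Qed.

Lemma ln_lam_gt0 : 0 < ln lam. Proof. exact: ln_gt0. Qed.
Lemma ln_Lam_gt0 : 0 < ln Lam. Proof. by rewrite ln_gt0// Lam_gt1. Qed.

Lemma pressure_zero_exists : exists2 s, 0 <= s & pressure F s = 0.
Proof.
exact: (decreasing_lipschitz_zero ln_lam_gt0 ln_Lam_gt0 pressure0_ge0
  pressure_shift).
Qed.

(** * Sums over the semigroup *)

Lemma sum_level_sum_bounded t : 0 <= t -> pressure F t < 0 ->
  exists C, forall K, \sum_(n < K) level_sum t n <= C.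
Proof.
move=> t0 Pt; pose q := expR (pressure F t / 2).
have q0 : 0 < q := expR_gt0 _.
have q1 : q < 1 by rewrite expR_lt1; lra.
have [N _ HN] : \forall n \near \oo, pressure_seq F t n <= pressure F t / 2.
  by apply: (cvgr_le (pressure F t) (pressure_cvg t0)); lra.
have SN n : (N < n)%N -> level_sum t n <= q ^+ n.
  move=> Nn; have n0 : (0 < n)%N by apply: leq_ltn_trans Nn.
  have := HN n (ltnW Nn); rewrite pressure_seqE ler_pdivrMl ?ltr0n// => h.
  rewrite -ler_ln ?posrE ?level_sum_gt0 ?exprn_gt0// lnXn// expRK.
  by rewrite mulr_natl in h.
(* The bound level_sum t n <= q ^+ n only holds for n > N; the constant A
   absorbs the first N + 1 terms. *)
pose A := 1 + \sum_(n < N.+1) level_sum t n / q ^+ n.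
have u0 n : 0 <= level_sum t n / q ^+ n.
  by rewrite divr_ge0 ?level_sum_ge0// exprn_ge0// ltW.
have SA n : level_sum t n <= A * q ^+ n.
  have [Nn|nN] := ltnP N n.
    apply: (le_trans (SN n Nn)).
    rewrite ler_peMl ?exprn_ge0//; first exact: ltW.
    by rewrite lerDl sumr_ge0.
  rewrite -ler_pdivrMr ?exprn_gt0// /A.
  have nN' : (n < N.+1)%N by [].
  rewrite (bigD1 (Ordinal nN'))//= addrCA lerDl addr_ge0// sumr_ge0//.
exists (A * (1 - q)^-1) => K.
apply: (@le_trans _ _ (\sum_(n < K) A * q ^+ n)).
  by apply: ler_sum => n _; exact: SA.
rewrite -mulr_sumr ler_wpM2l//; first by rewrite addr_ge0// sumr_ge0.
by rewrite sum_expr_le// (ltW q0).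
Qed.

(** A map occurring in several levels is counted several times on the right-hand
    side. *)
Lemma sum_le_level_sums t (X : seq (R -> R)) : uniq X ->
  (forall g, g \in X -> exists w, g = word_map F w) ->
  exists K, \sum_(g <- X) `|lincoef g| `^ (- t) <= \sum_(n < K) level_sum t n.
Proof.
move=> uX Xw; have [K HK] : exists K, forall g, g \in X ->
    exists2 n, (n < K)%N & g \in level_fset n.
  elim: X Xw {uX} => [|g X IH] Xw; first by exists 0%N.
  have [h hX|K HK] := IH; first by apply: Xw; rewrite inE hX orbT.
  have [w gw] := Xw g (mem_head _ _).
  exists (maxn K (size w).+1) => h; rewrite inE => /orP[/eqP ->|/HK[n nK hn]].
    exists (size w); first by rewrite leq_max leqnn orbT.
    by apply/level_fsetP; exists w.
  by exists n => //; rewrite leq_max nK.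
exists K.
have -> : \sum_(n < K) level_sum t n =
    \sum_(g <- flatten [seq (level_fset n : seq (R -> R)) | n <- iota 0 K])
      `|lincoef g| `^ (- t).
  rewrite big_flatten big_map -(big_mkord xpredT (level_sum t)).
  by rewrite /index_iota subn0.
apply: ler_sum_sub_seq => // g /HK[n nK gn]; apply/flattenP.
exists (level_fset n : seq (R -> R)) => //; apply/mapP; exists n => //.
by rewrite mem_iota.
Qed.

Lemma size_bounded x : exists K, forall w, ratio w <= x -> (size w < K)%N.
Proof.
have [K xK] := expr_gt_exists x lam_gt1; exists K => w wx.
rewrite -(@ltr_eXn2l _ lam)//; apply: le_lt_trans xK.
exact: le_trans (ratio_ge w) wx.
Qed.

(** * Counting the maps of bounded linear coefficient *)

(** The maps of the semigroup, with the identity (the map of the empty word)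
    added, whose linear coefficient is at most x in absolute value. The
    identity is needed because one of the two parts of a cut word may be empty. *)
Definition words_le x : set (R -> R) :=
  [set g | (exists w, g = word_map F w) /\ `|lincoef g| <= x].

Lemma finite_words_le x : finite_set (words_le x).
Proof.
have [K HK] := size_bounded x.
apply: (@sub_finite_set _ _ (\bigcup_(n in `I_K) level F n)).
  move=> g [[w ->]]; rewrite lincoef_word_map => wx.
  by exists (size w); [exact: HK | apply/levelP; exists w].
by apply: bigcup_finite => // n _; exact: finite_level.
Qed.

Definition words_le_fset x := fset_set (words_le x).

Lemma words_le_fsetP x g : reflect (exists2 w, ratio w <= x & g = word_map F w)
  (g \in words_le_fset x).
Proof.
rewrite in_fset_set; last exact: finite_words_le.
apply: (iffP idP); rewrite inE.
  by move=> [[w ->]]; rewrite lincoef_word_map; exists w.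
by move=> [w wx ->]; split; [exists w | rewrite lincoef_word_map].
Qed.

(** The number N(x) of the maps of words_le x. *)
Definition count_le x : nat := #|` words_le_fset x|.

(** Cutting w after its longest prefix of ratio at most z: either this prefix is
    w itself, or one more letter, of ratio at most Lam, takes it beyond z. *)
Lemma word_split z w : 1 <= z ->
  exists u v, [/\ w = u ++ v, ratio u <= z & v = [::] \/ z < Lam * ratio u].
Proof.
elim: w z => [|i w IH] z z1.
  by exists [::], [::]; split=> //; [rewrite /ratio big_nil | left].
have /andP[h1 h2] := ratio_bounds i.
have ri0 : 0 < `|r i| := lt_le_trans lam_gt0 h1.
have [riz|zri] := lerP `|r i| z.
  have [|u [v [-> uz uv]]] := IH (z / `|r i|).
    by rewrite ler_pdivlMr// mul1r.
  exists (i :: u), v; rewrite /ratio big_cons -/(ratio u); split=> //.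
    by rewrite mulrC -ler_pdivlMr.
  case: uv => [->|uv]; [by left | right].
  by rewrite mulrCA mulrC -ltr_pdivrMr.
exists [::], (i :: w); split=> //; first by rewrite /ratio big_nil.
by right; rewrite /ratio big_nil mulr1; exact: lt_le_trans zri h2.
Qed.

Lemma count_le_submul x y : 1 <= x -> 1 <= y ->
  (count_le (Lam * (x * y)) <= count_le (Lam * x) * count_le (Lam * y))%N.
Proof.
move=> x1 y1; rewrite /count_le.
rewrite -(size_allpairs (fun g h : R -> R => g \o h)) uniq_leq_size//.
move=> g /words_le_fsetP[w wxy ->].
have Lz z : 1 <= z -> 1 <= Lam * z.
  by move=> z1; rewrite -[1]mulr1 ler_pM// ltW ?Lam_gt1.
have [u [v [wuv ux uv]]] := word_split w (Lz _ x1).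
apply/allpairsP; exists (word_map F u, word_map F v) => /=.
rewrite -word_map_cat -wuv; split=> //; apply/words_le_fsetP; first by exists u.
exists v => //; case: uv => [->|]; first by rewrite /ratio big_nil Lz.
rewrite ltr_pM2l ?Lam_gt0// => xu.
rewrite -(ler_pM2l (lt_le_trans ltr01 x1)).
apply: (@le_trans _ _ (ratio u * ratio v)).
  by rewrite ler_wpM2r ?(ltW xu)// ltW ?ratio_gt0.
by rewrite -ratio_cat -wuv mulrCA.
Qed.

Lemma count_le_expr x k : 1 <= x ->
  (count_le (Lam * x ^+ k.+1) <= count_le (Lam * x) ^ k.+1)%N.
Proof.
move=> x1; elim: k => [//|k IH]; rewrite exprS expnS.
apply: leq_trans (count_le_submul x1 (exprn_ege1 _ x1)) _.
by rewrite leq_mul2l IH orbT.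
Qed.

(** The sum of |g'|^-t over the maps of words_le x. *)
Definition sum_le t x := \sum_(g <- words_le_fset x) `|lincoef g| `^ (- t).

(** The maps with x < |g'| <= y contribute at most x^-t each. *)
Lemma sum_le_step t x y : 0 <= t -> 0 < x ->
  sum_le t y <= sum_le t x + (count_le y)%:R * x `^ (- t).
Proof.
move=> t0 x0.
rewrite /sum_le (bigID (fun g : R -> R => `|lincoef g| <= x))/= lerD//.
  rewrite -big_filter; apply: ler_sum_sub_seq => //.
    exact/filter_uniq/fset_uniq.
  move=> g; rewrite mem_filter => /andP[gx /words_le_fsetP[w _ gw]].
  by apply/words_le_fsetP; exists w; rewrite // -lincoef_word_map -gw.
apply: (@le_trans _ _ (\sum_(g <- words_le_fset y) x `^ (- t))); last first.
  by rewrite big_const_seq count_predT iter_addr_0 mulr_natl.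
rewrite big_mkcond; apply: ler_sum => g _; case: ifP => [|_]; last first.
  exact: powR_ge0.
by rewrite -ltNge => xg; exact/powRN_homo/ltW.
Qed.

(** The shell Lam x^k < |g'| <= Lam x^(k+1) contributes at most
    c^(k+1) x^(-tk) = c q^k, with c = N(Lam x) and q = c x^-t < 1. *)
Lemma level_sum_bounded_of_count t x : 0 <= t -> 1 < x ->
  (count_le (Lam * x))%:R < x `^ t -> exists C, forall n, level_sum t n <= C.
Proof.
move=> t0 x1 cx; have x0 : 0 < x := lt_trans ltr01 x1.
set c := (count_le (Lam * x))%:R in cx.
have c0 : 0 <= c by rewrite ler0n.
pose q := c * x `^ (- t).
have q0 : 0 <= q by rewrite mulr_ge0// powR_ge0.
have q1 : q < 1 by rewrite /q powRN ltr_pdivrMr ?powR_gt0// mul1r.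
have B k : sum_le t (Lam * x ^+ k) <= sum_le t Lam + c * \sum_(i < k) q ^+ i.
  elim: k => [|k IH]; first by rewrite expr0 mulr1 big_ord0 mulr0 addr0.
  have Lk : 0 < Lam * x ^+ k by rewrite mulr_gt0 ?Lam_gt0 ?exprn_gt0.
  apply: (le_trans (sum_le_step _ t0 Lk)).
  rewrite big_ord_recr/= mulrDr addrA lerD//.
  have -> : c * q ^+ k = c ^+ k.+1 * (x ^+ k) `^ (- t).
    rewrite /q exprMn mulrA -exprS; by rewrite powRX ?ltW.
  apply: ler_pM => //; first exact: powR_ge0.
    by rewrite /c -natrX ler_nat count_le_expr// ltW.
  apply: powRN_homo => //; first by rewrite exprn_gt0.
  by rewrite ler_peMl ?exprn_ge0 ?(ltW x0)// ltW ?Lam_gt1.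
exists (sum_le t Lam + c * (1 - q)^-1) => n.
have [k Lk] := expr_gt_exists (Lam ^+ n) x1.
apply: (@le_trans _ _ (sum_le t (Lam * x ^+ k))).
  apply: ler_sum_sub_seq => // g /level_fsetP[w wn ->].
  apply/words_le_fsetP; exists w => //.
  rewrite (le_trans (ratio_le w))// wn (le_trans (ltW Lk))//.
  by rewrite ler_peMl ?exprn_ge0 ?(ltW x0)// ltW ?Lam_gt1.
by apply: (le_trans (B k)); rewrite lerD2l ler_wpM2l// sum_expr_le// q0.
Qed.

Lemma pressure_le0 t C :
  0 <= t -> (forall n, (0 < n)%N -> level_sum t n <= C) ->
  pressure F t <= 0.
Proof.
move=> t0 SC; apply/ler_addgt0Pr => e e0; rewrite add0r.
apply: limr_le; first exact: pressure_cvg.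
near=> n; have n0 : (0 < n)%N by near: n; exact: nbhs_infty_gt.
rewrite pressure_seqE ler_pdivrMl ?ltr0n//.
have C0 : 0 < C := lt_le_trans (level_sum_gt0 t n) (SC n n0).
apply: (@le_trans _ _ (ln C)).
  by rewrite ler_ln ?posrE ?level_sum_gt0 ?SC.
by rewrite -ler_pdivrMr//; near: n; exact: nbhs_infty_ger.
Unshelve. all: by end_near. Qed.

(** * Comparison with the zero of the pressure *)

Section Zero.
Context (s0 : R) (s0_ge0 : 0 <= s0) (Ps0 : pressure F s0 = 0).

Lemma pressure_lt0 t : s0 < t -> pressure F t < 0.
Proof.
move=> st; have /andP[_ h] := pressure_shift s0_ge0 (ltW st).
apply: (le_lt_trans h); rewrite Ps0 sub0r oppr_lt0 mulr_gt0 ?ln_lam_gt0//.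
by rewrite subr_gt0.
Qed.

Lemma pressure_gt0 t : 0 <= t -> t < s0 -> 0 < pressure F t.
Proof.
move=> t0 ts; have /andP[_] := pressure_shift t0 (ltW ts).
rewrite Ps0 subr_ge0; apply: lt_le_trans; rewrite mulr_gt0 ?ln_lam_gt0//.
by rewrite subr_gt0.
Qed.

Lemma zero_le_of_level_sum_bounded t C :
  0 <= t -> (forall n, (0 < n)%N -> level_sum t n <= C) ->
  s0 <= t.
Proof.
move=> t0 SC; rewrite leNgt; apply/negP => /(pressure_gt0 t0).
by rewrite ltNge (pressure_le0 t0 SC).
Qed.

Lemma sum_words_bounded t : s0 < t -> exists C, forall X : seq (R -> R),
  uniq X -> (forall g, g \in X -> exists w, g = word_map F w) ->
  \sum_(g <- X) `|lincoef g| `^ (- t) <= C.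
Proof.
move=> st; have t0 := le_trans s0_ge0 (ltW st).
have [C HC] := sum_level_sum_bounded t0 (pressure_lt0 st).
exists C => X uX Xw; have [K HK] := sum_le_level_sums t uX Xw.
exact: le_trans HK (HC K).
Qed.

(** If N(Lam x) = x^d, then level_sum_bounded_of_count applies to d + e for
    every e > 0, and the
    level sums can be bounded only for exponents >= s0. *)
Lemma ln_count_ge x : 1 < x -> s0 * ln x <= ln (count_le (Lam * x))%:R.
Proof.
move=> x1; have x0 : 0 < x := lt_trans ltr01 x1.
have lx0 : 0 < ln x by rewrite ln_gt0.
have c0 : 0 < (count_le (Lam * x))%:R :> R.
  rewrite ltr0n lt0n cardfs_eq0; apply/fset0Pn; exists id.
  apply/words_le_fsetP; exists [::] => //.
  by rewrite /ratio big_nil -[1]mulr1 ler_pM// ltW ?Lam_gt1.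
rewrite -ler_pdivlMr//; set d := _ / _.
have d0 : 0 <= d by rewrite divr_ge0 ?ln_ge0 ?ler1n -?(ltr0n R)// ltW.
apply/ler_addgt0Pr => e e0.
have de : 0 <= d + e by rewrite addr_ge0// ltW.
have [|C HC] := @level_sum_bounded_of_count (d + e) x de x1.
  rewrite -ltr_ln ?posrE ?powR_gt0// ln_powR -ltr_pdivrMr//.
  by rewrite ltrDl.
by apply: (@zero_le_of_level_sum_bounded _ C) => // n _; exact: HC.
Qed.

Lemma count_le_powR t : s0 < t -> exists2 C, 0 < C & forall x, 0 < x ->
  (count_le x)%:R <= C * x `^ t.
Proof.
move=> st; have t0 := le_trans s0_ge0 (ltW st).
have [C HC] := sum_words_bounded st.
exists (Num.max C 1); first by rewrite lt_max ltr01 orbT.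
move=> x x0; rewrite -ler_pdivrMr ?powR_gt0// -powRN le_max; apply/orP; left.
apply: le_trans (HC (words_le_fset x) (fset_uniq _) _); last first.
  by move=> g /words_le_fsetP[w _ ->]; exists w.
have -> : (count_le x)%:R * x `^ (- t) =
    \sum_(g <- words_le_fset x) x `^ (- t).
  by rewrite big_const_seq count_predT iter_addr_0 mulr_natl.
rewrite big_seq [leRHS]big_seq; apply: ler_sum => g /words_le_fsetP[w wx ->].
rewrite lincoef_word_map; apply: powRN_homo => //; exact: ratio_gt0.
Qed.

(** The set counted by growth_ratio; unlike words_le x, it need not contain the
    identity, which accounts for the 1 in card_Gstar_le. *)
Definition Gstar_le x : set (R -> R) :=
  [set g | Gstar F g /\ `|lincoef g| <= x].

Lemma GstarP g : Gstar F g <->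
  exists2 w, (0 < size w)%N & g = word_map F w.
Proof.
split=> [[n n0 /levelP[w wn ->]]|[w w0 ->]]; first by exists w; rewrite ?wn.
by exists (size w) => //; apply/levelP; exists w.
Qed.

Lemma Gstar_le_sub x : Gstar_le x `<=` words_le x.
Proof. by move=> g [/GstarP[w _ ->] h]; split=> //; exists w. Qed.

Lemma finite_Gstar_le x : finite_set (Gstar_le x).
Proof. exact: sub_finite_set (@Gstar_le_sub x) (finite_words_le x). Qed.

Lemma card_Gstar_le x :
  (#|` fset_set (Gstar_le x)| <= count_le x <=
   (#|` fset_set (Gstar_le x)|).+1)%N.
Proof.
have [fin finw] := (finite_Gstar_le x, finite_words_le x).
apply/andP; split.
  apply: uniq_leq_size => // g; rewrite !in_fset_set//.
  by rewrite !inE => /Gstar_le_sub.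
rewrite -[X in (_ <= X)%N]
  /(size (id :: (fset_set (Gstar_le x) : seq (R -> R)))).
apply: uniq_leq_size => // g /words_le_fsetP[w wx ->]; rewrite in_cons.
case: w wx => [|i w] wx; first by rewrite eqxx.
rewrite in_fset_set// orbC; apply/orP; left; rewrite inE; split.
  by apply/GstarP; exists (i :: w).
by rewrite lincoef_word_map.
Qed.

Lemma growth_cvg : growth_ratio F x @[x --> +oo] --> s0.
Proof.
apply/cvgrPdist_le => /= e e0.
have [C C0 HC] : exists2 C, 0 < C & forall x, 0 < x ->
  (count_le x)%:R <= C * x `^ (s0 + e / 2).
  by apply: count_le_powR; rewrite ltrDl divr_gt0.
near=> x.
have x1 : 1 < x by near: x; exact: nbhs_pinfty_gt.
have xL : Lam < x by near: x; apply: nbhs_pinfty_gt; exact: num_real.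
have x0 : 0 < x := lt_trans ltr01 x1.
have lx0 : 0 < ln x by rewrite ln_gt0.
have xC : ln C / (e / 2) <= ln x.
  by rewrite -ler_expR lnK ?posrE.
have xD : (s0 * ln Lam + ln 2) / e <= ln x.
  by rewrite -ler_expR lnK ?posrE.
move: xC xD; rewrite !ler_pdivrMr ?divr_gt0// => xC xD.
rewrite /growth_ratio -/(Gstar_le x); set N := #|` _ |.
have /andP[Nle leN] := card_Gstar_le x; rewrite -/N in Nle leN.
have N0 : (0 < N)%N.
  rewrite lt0n cardfs_eq0; apply/fset0Pn.
  exists (word_map F [:: Ordinal m_gt0]).
  rewrite in_fset_set; last exact: finite_Gstar_le.
  rewrite inE; split; first by apply/GstarP; exists [:: Ordinal m_gt0].
  by rewrite lincoef_word_map (le_trans (ratio_le _))// expr1 ltW.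
have N0' : 0 < N%:R :> R by rewrite ltr0n.
rewrite ler_distlC ler_pdivlMr// ler_pdivrMr//; apply/andP; split.
(* Lower bound: ln_count_ge at x / Lam, with count_le x <= N + 1 <= 2 N, the
   constants being absorbed by e ln x. *)
- have xL1 : 1 < x / Lam by rewrite ltr_pdivlMr ?Lam_gt0// mul1r.
  have := ln_count_ge xL1; rewrite [Lam * _]mulrC divfK ?gt_eqF ?Lam_gt0//.
  rewrite ln_div ?posrE ?Lam_gt0// => h.
  have cN : ln (count_le x)%:R <= ln 2 + ln N%:R :> R.
    rewrite -lnM ?posrE// -natrM ler_ln ?posrE ?ltr0n ?muln_gt0//.
      by rewrite ler_nat (leq_trans leN)// mul2n -addnn -addn1 leq_add2l.
    exact: leq_trans N0 Nle.
  lra.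
(* Upper bound: N <= count_le x <= C x^(s0 + e / 2) and ln C <= (e / 2) ln x. *)
- apply: (@le_trans _ _ (ln (count_le x)%:R)).
    by rewrite ler_ln ?posrE ?ler_nat// ltr0n (leq_trans N0).
  have : ln (count_le x)%:R <= ln C + (s0 + e / 2) * ln x.
    rewrite -ln_powR -lnM ?posrE ?powR_gt0//.
    rewrite ler_ln ?posrE ?mulr_gt0 ?powR_gt0//; first exact: HC.
    by rewrite ltr0n (leq_trans N0).
  lra.
Unshelve. all: by end_near. Qed.

Lemma growth_exponentE : growth_exponent F = s0.
Proof. exact/cvg_lim/growth_cvg. Qed.

Lemma pressure_eq0 t : 0 <= t -> pressure F t = 0 <-> t = s0.
Proof.
move=> t0; split=> [Pt|->//]; case: (ltgtP t s0) => // ts.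
- by have := pressure_gt0 t0 ts; rewrite Pt ltxx.
- by have := pressure_lt0 ts; rewrite Pt ltxx.
Qed.

Lemma poincare_lty t : s0 < t -> (poincare_series F t < +oo)%E.
Proof.
move=> st; have [C HC] := sum_words_bounded st.
apply: (@le_lt_trans _ _ C%:E); last exact: ltry.
apply: ge_ereal_sup => _ [X [finX XG] <-].
rewrite fsbig_finite//= sumEFin lee_fin; apply: HC => [|g].
  exact: fset_uniq.
by rewrite in_fset_set// inE => /XG/GstarP[w _ ->]; exists w.
Qed.

Lemma zero_le_of_poincare_lty t :
  0 <= t -> (poincare_series F t < +oo)%E -> s0 <= t.
Proof.
move=> t0 fin.
apply: (@zero_le_of_level_sum_bounded _ (fine (poincare_series F t))) => //.
move=> n n0.
have SP : ((level_sum t n)%:E <= poincare_series F t)%E.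
  apply: esum_ge; exists (level F n).
    split; first exact: finite_level.
    by move=> g; exists n.
  rewrite fsbig_finite; last exact: finite_level.
  by rewrite sumEFin.
rewrite -lee_fin fineK// fin_real//; apply/andP; split=> //.
exact: lt_le_trans (ltNyr _) SP.
Qed.

Lemma critical_exponentE : critical_exponent F = s0%:E.
Proof.
apply/le_anti/andP; split.
- apply/lee_addgt0Pr => e e0; apply: ereal_inf_lbound.
  exists (s0 + e) => //; split; first by rewrite addr_ge0// ltW.
  by apply: poincare_lty; rewrite ltrDl.
- apply: le_ereal_inf_tmp => _ [t [t0 Pt] <-]; rewrite lee_fin.
  exact: zero_le_of_poincare_lty.
Qed.

End Zero.

End Expanding.

Theorem proposition4p12 (R : realType) (m : nat) (r b : 'I_m -> R)
    (F := fun i : 'I_m => affine (r i) (b i)) :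
  (0 < m)%N ->
  (forall i, 1 < `|r i|) ->
  injective F ->
  (forall t : R, 0 <= t -> cvgn (pressure_seq F t)) /\
  [/\ cvg (growth_ratio F x @[x --> +oo]),
      (forall t : R, 0 <= t -> (pressure F t = 0 <-> t = growth_exponent F)),
      0 <= growth_exponent F
    & critical_exponent F = (growth_exponent F)%:E].
Proof.
move=> m0 r1 _.
have [lam [Lam [lam1 rb]]] : exists lam Lam, 1 < lam /\
    forall i, lam <= `|r i| <= Lam.
  have [i _ hi] := Order.TotalTheory.arg_minP (fun i => `|r i|)
    (isT : xpredT (Ordinal m0)).
  have [j _ hj] := Order.TotalTheory.arg_maxP (fun i => `|r i|)
    (isT : xpredT (Ordinal m0)).
  exists `|r i|, `|r j|; split=> // k.
  by apply/andP; split; [exact: hi | exact: hj].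
have [s s0 Ps] := pressure_zero_exists b m0 lam1 rb.
rewrite /F (growth_exponentE m0 lam1 rb s0 Ps).
split; first by move=> t; exact: (pressure_cvg m0 lam1 rb).
split.
- by apply/cvg_ex; exists s; exact: (growth_cvg m0 lam1 rb).
- by move=> t; exact: (pressure_eq0 m0 lam1 rb).
- exact: s0.
- exact: (critical_exponentE m0 lam1 rb).
Qed.
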